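(* Let $n\ge 1$, let $X_1,\dots,X_n$ be Polish spaces and let $\Omega=X_1\times X_2\times\cdots\times X_n$. If $\mu$ is a simplicial probability measure on the Borel subsets of $\Omega$, then $\mu$ admits a good Borel set as support; that is, there is a Borel set $S\subset\Omega$ with $\mu(S)=1$ such that $S$ is good.
   Context: A probability measure $\mu$ on (the Borel sets of) $\Omega$ is simplicial if $\mu$ is an extreme point of the convex set of all Borel probability measures $\lambda$ on $\Omega$ whose one-dimensional marginals (the push-forwards to $X_1,\dots,X_n$ under the coordinate projections) are the same as those of $\mu$. A set $S\subset X_1\times\cdots\times X_n$ is good if every function $f:S\to\mathbb{C}$ (with no measurability assumed) can be written as $f(x_1,\dots,x_n)=u_1(x_1)+\cdots+u_n(x_n)$ for all $(x_1,\dots,x_n)\in S$, for some functions $u_i:X_i\to\mathbb{C}$. ''Support'' of $\mu$ means a Borel set of full $\mu$-measure (not the topological support). *)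

(* Defs.v *)
From HB Require Import structures.
From mathcomp Require Import all_boot all_order all_algebra.
From mathcomp Require Import complex.
From mathcomp Require Import all_classical all_reals all_analysis.

Set Implicit Arguments.
Unset Strict Implicit.
Unset Printing Implicit Defensive.

Import Order.TTheory GRing.Theory Num.Theory.
Import numFieldNormedType.Exports.

Local Open Scope classical_set_scope.
Local Open Scope ring_scope.

Definition separable (T : topologicalType) : Prop :=
  exists2 D : set T, countable D & dense D.

(* The condition of [Uniform_isComplete], without requiring a base point. *)
Definition complete_uniform (U : uniformType) : Prop :=
  forall F : set_system U, ProperFilter F -> cauchy F ->
    exists l : U, F --> l.

(* A metricType carries its own topology, so the complete metric inducing the
   given topology of T is expressed on a homeomorphic copy M of T. *)
Definition completely_metrizable (R : realType) (T : topologicalType) : Prop :=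
  exists (M : metricType R) (f : T -> M) (g : M -> T),
    [/\ cancel f g, cancel g f, continuous f, continuous g
      & complete_uniform M].

Definition polish (R : realType) (T : topologicalType) : Prop :=
  separable T /\ completely_metrizable R T.

Notation borel T := (g_sigma_algebraType (@open T)).

(* The Borel sets of the product topology on the dependent product
   [forall i, X i]. *)
Notation product_borel X := (borel (prod_topology X)).

Definition factor_proj (n : nat) (X : 'I_n -> ptopologicalType) (i : 'I_n)
  (x : product_borel X) : borel (X i) := x i.

Lemma measurable_factor_proj (n : nat) (X : 'I_n -> ptopologicalType) (i : 'I_n) :
  measurable_fun [set: product_borel X] (@factor_proj n X i).
Proof.
apply: (@measurability _ _ (product_borel X) (borel (X i)) setT (@factor_proj n X i)
  (@open (X i))) => //.
move=> _ [B oB <-]; rewrite setTI; apply: sub_sigma_algebra.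
have := @open_comp (prod_topology X) (X i) (@proj _ X i) B.
by apply=> // x _; exact: proj_continuous.
Qed.

Definition marginal (R : realType) (n : nat) (X : 'I_n -> ptopologicalType)
    (mu : probability (product_borel X) R) (i : 'I_n) :
    set (borel (X i)) -> \bar R :=
  pushforward mu (@factor_proj n X i).
Arguments marginal {R n X} mu i.

Definition same_marginals (R : realType) (n : nat)
    (X : 'I_n -> ptopologicalType)
    (lambda mu : probability (product_borel X) R) : Prop :=
  forall (i : 'I_n) (A : set (borel (X i))), measurable A ->
    marginal lambda i A = marginal mu i A.

(* Measures are functions on all subsets whose values off the sigma-algebra are
   irrelevant: equalities of measures are restricted to measurable sets. *)
Definition extreme_point d (T : measurableType d) (R : realType)
    (C : set (probability T R)) (mu : probability T R) : Prop :=
  C mu /\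
  forall (l1 l2 : probability T R) (t : R), C l1 -> C l2 -> 0 < t < 1 ->
    (forall A : set T, measurable A ->
      mu A = (t%:E * l1 A + (1 - t)%:E * l2 A)%E) ->
    forall A : set T, measurable A -> l1 A = mu A /\ l2 A = mu A.

Definition simplicial (R : realType) (n : nat) (X : 'I_n -> ptopologicalType)
    (mu : probability (product_borel X) R) : Prop :=
  extreme_point [set lambda | same_marginals lambda mu] mu.

Definition good (R : realType) (n : nat) (X : 'I_n -> Type)
    (S : set (prod_topology X)) : Prop :=
  forall f : set_type S -> R[i],
    exists u : forall i : 'I_n, X i -> R[i],
      forall x : set_type S, f x = \sum_(i < n) u i (val x i).

(* Main.v *)
(* Let H be the space of bounded measurable sums u_1(x_1) + ... + u_n(x_n) and f a
   bounded measurable function.  Along a sequence h_m in H minimising the integral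
   of phi(f - h), where phi is the Huber function and c = phi' truncates to [-1, 1],
   the functions c(f - h_m) are Cauchy in L^2 because phi is the conjugate of a
   strongly convex function; they converge a.e. to some g with |g| <= 1, and
   minimality makes g orthogonal to H.  Then (1 + g) mu and (1 - g) mu have the
   marginals of mu, so extremality forces g = 0 a.e., and hence h_m -> f a.e.

   Apply this to the indicators f of the finite intersections of sets
   {x | x_i in U}, with U in a countable family of open sets separating the points
   of X_i.  On the complement S of one null set, all these indicators are limits of
   sums; as they separate each point of S from any finite set of others, the
   functionals u |-> u_1(x_1) + ... + u_n(x_n), x in S, are linearly independent.
   A linear form taking prescribed values on them yields the required u. *)
From HB Require Import structures.
Require Import Defs.
From mathcomp Require Import all_boot all_order all_algebra.
From mathcomp Require Import complex.
From mathcomp Require Import all_classical all_reals all_analysis.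
From mathcomp Require Import measurable_realfun.
From mathcomp Require Import ring lra.

Set Implicit Arguments.
Unset Strict Implicit.
Unset Printing Implicit Defensive.

Import Order.TTheory GRing.Theory Num.Theory.
Import numFieldNormedType.Exports.

Local Open Scope classical_set_scope.
Local Open Scope ring_scope.

(** * Linear forms with prescribed values *)

(* A maximal subspace of [V * F] containing [G] and avoiding [(0, 1)] is the
   graph of a linear form. *)
Lemma linear_extension (F : fieldType) (V : lmodType F) (G : set (V * F^o)) :
  G 0 -> (forall a p q, G p -> G q -> G (a *: p + q)) -> ~ G (0, 1) ->
  exists L : {linear V -> F^o}, forall p, G p -> L p.1 = p.2.
Proof.
move=> G0 GL G1.
pose sub (A : set (V * F^o)) :=
  (forall a p q, A p -> A q -> A (a *: p + q)) /\ ~ A (0, 1).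
(* The property is imposed on [G] union [A] rather than on [A], so that it also holds for the union
   of the empty chain. *)
have [|A [[AL A1] Amax]] := @Zorn_bigcup _ (fun A => sub (G `|` A)).
  move=> C CP Ctot; split; last by case=> [//|[A /CP[_ +] A01]]; apply; right.
  move=> a p q [Gp|[A CA Ap]] [Gq|[B CB Bq]].
  - by left; exact: GL.
  - have [|] := (CP _ CB).1 a p q (or_introl Gp) (or_intror Bq).
      by left.
    by right; exists B.
  - have [|] := (CP _ CA).1 a p q (or_intror Ap) (or_introl Gq).
      by left.
    by right; exists A.
  - have [D [CD Dp Dq]] : exists D, [/\ C D, D p & D q].
      by have [AB|BA] := Ctot _ _ CA CB; [exists B|exists A]; split => //;
        [exact: AB|exact: BA].
    have [|] := (CP _ CD).1 a p q (or_intror Dp) (or_intror Dq).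
      by left.
    by right; exists D.
set M := G `|` A in AL A1.
have M0 : M 0 by left.
have MZ a p : M p -> M (a *: p) by move=> Mp; rewrite -[_ *: _]addr0; exact: AL.
have MB p q : M p -> M q -> M (p - q).
  by move=> Mp Mq; rewrite addrC -scaleN1r; exact: AL.
have Mtot v : exists a, M (v, a).
  apply: contrapT => /forallNP Mv.
  (* [N] is [M] plus the line through [(v, 0)], hence strictly larger. By maximality it contains
     [(0, 1)] = [(w, b) + c *: (v, 0)]; here [c] is nonzero because [M] avoids [(0, 1)], and
     rescaling puts [(v, - c^-1)] in [M]. *)
  pose N := [set r | exists q c, M q /\ r = q + c *: (v, 0) :> V * F^o].
  have MN : M `<=` N by move=> q Mq; exists q, 0; rewrite scale0r addr0.
  apply: (Amax N).
    split; first by move=> q Aq; apply: MN; right.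
    move=> /(_ (v, 0)) NA; apply: (Mv 0); right; apply: NA.
    by exists 0, 1; rewrite scale1r add0r.
  rewrite (_ : G `|` N = N); last first.
    by apply/setUidPr => q Gq; apply: MN; left.
  split=> [a _ _ [p [c [Mp ->]]] [q [d [Mq ->]]]|[[w b] [c [Mq]]]].
    exists (a *: p + q), (a * c + d); split; first exact: AL.
    by rewrite scalerDr scalerDl scalerA addrACA.
  move=> [/esym/eqP]; rewrite addr_eq0 => /eqP wE; rewrite scaler0 addr0 => b1.
  have [c0|c0] := eqVneq c 0.
    by apply: A1; move: Mq; rewrite wE c0 scale0r oppr0 b1.
  apply: (Mv (- c^-1)).
  have := MZ (- c^-1) _ Mq; rewrite wE -b1.
  rewrite (_ : _ *: _ = (v, - c^-1 : F^o))//; congr (_, _); last exact: mulr1.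
  by rewrite /= scalerN scaleNr opprK scalerA mulVf// scale1r.
have Mfun v a b : M (v, a) -> M (v, b) -> a = b.
  move=> Ma Mb; apply: contrapT => /eqP; rewrite -subr_eq0 => ab.
  apply: A1; have := MZ (a - b)^-1 _ (MB _ _ Ma Mb).
  by rewrite (_ : _ *: _ = (0, 1 : F^o))//; congr (_, _);
    rewrite /= ?subrr ?scaler0//; exact: mulVf.
pose L v := projT1 (cid (Mtot v)).
have ML v : M (v, L v) by exact: projT2 (cid (Mtot v)).
have Llin : linear (L : V -> F^o).
  by move=> a u v; apply: Mfun (ML _) _; exact: (AL a (u, L u) (v, L v)).
pose L' : {linear V -> F^o} := HB.pack (L : V -> F^o) (GRing.isLinear.Build _ _ _ _ _ Llin).
by exists L' => -[v a] Gva; apply: Mfun (ML v) _; left.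
Qed.

(** The pairs of combinations of the [e x] and of the [f x] with the same coefficients form a
    subspace; the hypothesis on linear relations says exactly that it avoids [(0, 1)]. *)
Lemma linear_interpolation (F : fieldType) (V : lmodType F) (P : Type)
    (e : P -> V) (f : P -> F) :
  (forall l : seq (F * P), \sum_(p <- l) p.1 *: e p.2 = 0 ->
    \sum_(p <- l) p.1 * f p.2 = 0) ->
  exists L : {linear V -> F^o}, forall x, L (e x) = f x.
Proof.
move=> ef.
pose G := [set p : V * F^o | exists l : seq (F * P),
  p = (\sum_(p <- l) p.1 *: e p.2, \sum_(p <- l) p.1 * f p.2)].
have [||[l [/esym/ef -> /eqP]]|L LG] := @linear_extension F V G.
- by exists [::]; rewrite !big_nil.
- move=> a _ _ [l ->] [m ->].
  exists ([seq (a * p.1, p.2) | p <- l] ++ m).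
  rewrite !big_cat !big_map/=; congr (_, _) => /=; congr (_ + _).
    by rewrite scaler_sumr; apply: eq_bigr => p _; rewrite scalerA.
  by rewrite [LHS]mulr_sumr; apply: eq_bigr => p _; rewrite mulrA.
- by rewrite oner_eq0.
- exists L => x; apply: (LG (e x, f x)).
  by exists [:: (1, x)]; rewrite !big_seq1/= scale1r mul1r.
Qed.

(** Evaluating a linear relation between the [e x] along [v] and passing to the limit isolates the
    total coefficient of [x], which is therefore 0. So the [e x] are linearly independent. *)
Lemma interpolation_of_separation (R : realType) (P : eqType) (U : Type)
    (e : P -> U -> R^o) :
  (forall (x : P) (s : seq P), x \notin s ->
    exists v : nat -> U, e x (v m) @[m --> \oo] --> (1 : R) /\
      forall y, y \in s -> e y (v m) @[m --> \oo] --> (0 : R)) ->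
  forall f : P -> R, exists L : {linear (U -> R^o) -> R^o}, forall x, L (e x) = f x.
Proof.
move=> sep f; apply: linear_interpolation => l l0.
have coef x : \sum_(p <- l | p.2 == x) p.1 = 0.
  have [|v [v1 v0]] := sep x [seq p.2 | p <- l & p.2 != x].
    by apply/mapP => -[p +]; rewrite mem_filter => /andP[/eqP px _] /esym.
  have cv p : p \in l ->
      p.1 * e p.2 (v m) @[m --> \oo] --> (if p.2 == x then p.1 else 0).
    move=> pl; case: ifPn => [/eqP ->|px].
      by rewrite -[X in _ --> X]mulr1; apply: cvgMl_tmp.
    rewrite -[X in _ --> X](mulr0 p.1); apply: cvgMl_tmp; apply: v0.
    by apply/mapP; exists p; rewrite // mem_filter px.
  have : (fun m => \sum_(p <- l) p.1 * e p.2 (v m)) @ \oo -->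
      \sum_(p <- l) (if p.2 == x then p.1 else 0).
    elim: (l) cv => [|p t IH] cv.
      under eq_cvg do rewrite big_nil.
      by rewrite big_nil; exact: cvg_cst.
    under eq_cvg do rewrite big_cons.
    rewrite big_cons; apply: cvgD; first by apply: cv; rewrite mem_head.
    by apply: IH => q qt; apply: cv; rewrite in_cons qt orbT.
  rewrite -big_mkcond/= => /cvg_lim <-//.
  have -> : (fun m => \sum_(p <- l) p.1 * e p.2 (v m)) = fun=> 0.
    apply/funext => m; have := congr1 (@^~ (v m)) l0.
    by rewrite fct_sumE.
  by apply/cvg_lim => //; exact: cvg_cst.
pose s := undup [seq p.2 | p <- l].
(* A point may occur several times in [l]: the terms are grouped by point before [coef] applies. *)
transitivity (\sum_(p <- l) \sum_(x <- s) (if p.2 == x then p.1 * f x else 0)).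
  apply: eq_big_seq => p pl; rewrite (bigD1_seq p.2) ?undup_uniq//=; last first.
    by rewrite mem_undup; apply/mapP; exists p.
  by rewrite eqxx big1 ?addr0// => x /negPf; rewrite eq_sym => ->.
rewrite exchange_big big1// => x _.
by rewrite -big_mkcond -mulr_suml coef mul0r.
Qed.

(** * The Huber function and its convexity estimates *)

Section huber.
Context {R : realType}.
Implicit Types a b s t : R.

Definition clamp t : R := Num.min 1 (Num.max (-1) t).

(* The Huber function; its derivative is [clamp]. *)
Definition huber t : R := clamp t * t - clamp t ^+ 2 / 2.

Lemma clamp_cases t : [\/ t <= -1 /\ clamp t = -1,
  -1 <= t <= 1 /\ clamp t = t | 1 <= t /\ clamp t = 1].
Proof.
rewrite /clamp; have [t1|t1] := leP t (-1).
  by constructor 1; rewrite min_r//; lra.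
have [t2|t2] := leP 1 t; first by constructor 3.
by constructor 2; rewrite !ltW.
Qed.

Lemma clamp_itv t : -1 <= clamp t <= 1.
Proof. by have [[_ ->]|[t1 ->]|[_ ->]] := clamp_cases t => //; apply/andP; lra. Qed.

Lemma clamp_id t : -1 <= t <= 1 -> clamp t = t.
Proof. by move=> /andP[t1 t2]; rewrite /clamp max_r// min_r. Qed.

(* [huber] is the convex conjugate of [s ^+ 2 / 2] restricted to [-1, 1]. *)
Lemma huber_conjugate s t : -1 <= s <= 1 ->
  s * t - s ^+ 2 / 2 + (clamp t - s) ^+ 2 / 2 <= huber t.
Proof.
move=> /andP[s1 s2]; rewrite /huber -subr_ge0.
have : 0 <= (clamp t - s) * (t - clamp t).
  by have [[t1 ->]|[_ ->]|[t1 ->]] := clamp_cases t; nra.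
lra.
Qed.

Lemma huber_ge0 t : 0 <= huber t.
Proof.
have := @huber_conjugate 0 t; have := sqr_ge0 (clamp t - 0); lra.
Qed.

(** The derivative [clamp] is 1-Lipschitz, whence the quadratic upper bound. It follows from the
    conjugate inequality at [a] with slope [clamp (a + b)], by completing a square. *)
Lemma huberD_le a b : huber (a + b) <= huber a + clamp a * b + b ^+ 2 / 2.
Proof.
have := huber_conjugate a (clamp_itv (a + b)).
have := sqr_ge0 (clamp a - clamp (a + b) + b).
rewrite /huber; lra.
Qed.

(** Average the conjugate inequalities at [a] and [b], both with slope the [clamp] of the midpoint.
    The gain controls the distance of the derivatives only, as [huber] is affine far from 0. *)
Lemma huber_midpoint a b :
  huber ((a + b) / 2) + (clamp a - clamp b) ^+ 2 / 8 <= (huber a + huber b) / 2.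
Proof.
have := huber_conjugate a (clamp_itv ((a + b) / 2)).
have := huber_conjugate b (clamp_itv ((a + b) / 2)).
set s := clamp ((a + b) / 2).
have := sqr_ge0 ((clamp a - s) + (clamp b - s)).
rewrite [huber ((a + b) / 2)]/huber -/s; lra.
Qed.

(** Once [clamp (u m)] has absolute value below 1, it equals [u m]. *)
Lemma cvg_clamp0 (u : nat -> R) :
  clamp (u m) @[m --> \oo] --> (0 : R) -> u m @[m --> \oo] --> (0 : R).
Proof.
move=> cu; apply: cvg_trans (cu); apply: near_eq_cvg.
have : \forall m \near \oo, `|clamp (u m)| < 1.
  by move/cvgr0_norm_lt : cu; apply.
apply: filterS => m; rewrite ltr_norml.
by have [[_ ->]|[_ ->]|[_ ->]] := clamp_cases (u m); rewrite ?ltxx ?andbF.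
Qed.

End huber.

(** * Bounded measurable functions and almost everywhere convergence *)

Section bounded_measurable.
Context d (T : measurableType d) (R : realType).
Implicit Types f g : T -> R.

Definition bounded_measurable f :=
  measurable_fun setT f /\ exists M, forall x, `|f x| <= M.

Lemma bounded_measurable_cst c : bounded_measurable (fun=> c).
Proof. by split; [exact: measurable_cst|exists `|c|]. Qed.

Lemma bounded_measurableD f g : bounded_measurable f -> bounded_measurable g ->
  bounded_measurable (fun x => f x + g x).
Proof.
move=> [mf [M fM]] [mg [N gN]]; split; first exact: measurable_funD.
by exists (M + N) => x; rewrite (le_trans (ler_normD _ _))// lerD.
Qed.

Lemma bounded_measurableM f g : bounded_measurable f -> bounded_measurable g ->
  bounded_measurable (fun x => f x * g x).
Proof.
move=> [mf [M fM]] [mg [N gN]]; split; first exact: measurable_funM.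
by exists (M * N) => x; rewrite normrM ler_pM.
Qed.

Lemma bounded_measurableZ c f : bounded_measurable f ->
  bounded_measurable (fun x => c * f x).
Proof. by apply: bounded_measurableM; exact: bounded_measurable_cst. Qed.

Lemma bounded_measurableB f g : bounded_measurable f -> bounded_measurable g ->
  bounded_measurable (fun x => f x - g x).
Proof.
move=> bf bg; under eq_fun do rewrite -mulN1r.
exact/bounded_measurableD/bounded_measurableZ.
Qed.

Lemma bounded_measurableX f n : bounded_measurable f ->
  bounded_measurable (fun x => f x ^+ n).
Proof.
move=> bf; elim: n => [|n IH].
  by under eq_fun do rewrite expr0; exact: bounded_measurable_cst.
by under eq_fun do rewrite exprS; exact: bounded_measurableM.
Qed.

Lemma bounded_measurable_norm f : bounded_measurable f ->
  bounded_measurable (fun x => `|f x|).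
Proof.
move=> [mf [M fM]]; split; first exact: measurableT_comp.
by exists M => x; rewrite normr_id.
Qed.

Lemma bounded_measurable_indic (A : set T) : measurable A ->
  bounded_measurable (\1_A : T -> R).
Proof.
move=> mA; split; first exact: measurable_indic.
by exists 1 => x; rewrite indicE; case: (_ \in _); rewrite ?normr0 ?normr1.
Qed.

Lemma measurable_clamp f : measurable_fun setT f ->
  measurable_fun setT (fun x => clamp (f x)).
Proof.
move=> mf; apply: (@measurable_minr _ _ _ _ (cst 1) (fun x => Num.max (-1) (f x))).
  exact: measurable_cst.
by apply: (@measurable_maxr _ _ _ _ (cst (-1))) => //; exact: measurable_cst.
Qed.

Lemma bounded_measurable_clamp f : measurable_fun setT f ->
  bounded_measurable (fun x => clamp (f x)).
Proof.
move=> mf; split; first exact: measurable_clamp.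
by exists 1 => x; rewrite ler_norml clamp_itv.
Qed.

Lemma bounded_measurable_huber f : bounded_measurable f ->
  bounded_measurable (fun x => huber (f x)).
Proof.
move=> bf; have bc := bounded_measurable_clamp bf.1.
apply: bounded_measurableB; first exact: bounded_measurableM.
by under eq_fun do rewrite mulrC; exact/bounded_measurableZ/bounded_measurableX.
Qed.

Variable P : probability T R.

Lemma bounded_measurable_integrable f (A : set T) : measurable A ->
  bounded_measurable f -> P.-integrable A (EFin \o f).
Proof.
move=> mA [mf [M fM]]; apply: measurable_bounded_integrable => //.
- by rewrite (le_lt_trans (probability_le1 P mA))// ltry.
- exact: measurable_funTS.
- exists M; split; first exact: num_real.
  by move=> N MN x _; apply: le_trans (fM x) _; exact: ltW.
Qed.

Lemma Rintegral_EFin f (A : set T) : measurable A -> bounded_measurable f ->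
  (\int[P]_(x in A) (f x)%:E)%E = (\int[P]_(x in A) f x)%:E.
Proof.
move=> mA bf; rewrite /Rintegral fineK// integrable_fin_num//.
exact: bounded_measurable_integrable.
Qed.

(** The sum [D] of the absolute increments has finite integral, so it is finite almost everywhere;
    there the telescoping series converges absolutely. *)
Lemma cvg_ae_of_summable (u : nat -> T -> R) :
  (forall m, bounded_measurable (u m)) ->
  (forall m, \int[P]_x `|u m x - u m.+1 x| <= 2 ^- m) ->
  \forall x \ae P, cvgn (u ^~ x).
Proof.
move=> bu intu.
have bd m : bounded_measurable (fun x => `|u m x - u m.+1 x|).
  exact/bounded_measurable_norm/bounded_measurableB.
pose D x := (\sum_(0 <= m <oo) `|u m x - u m.+1 x|%:E)%E.
have D0 x : (0 <= D x)%E by apply: nneseries_ge0 => m _ _; rewrite lee_fin.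
have mD : measurable_fun setT D.
  apply: ge0_emeasurable_sum => [m x _ _|m _]; first by rewrite lee_fin.
  exact/measurable_EFinP/(bd m).1.
have iD : P.-integrable setT D.
  apply/integrableP; split => //.
  under eq_integral do rewrite gee0_abs//.
  rewrite integral_nneseries//; last first.
    by move=> m; exact/measurable_EFinP/(bd m).1.
  (* The majorant is [2 ^- m], rewritten as a term of a geometric series of known sum. *)
  apply: (@le_lt_trans _ _ (\sum_(0 <= m <oo) ((2 : R) / (2 ^ (m + 1))%:R)%:E)%E).
    apply: lee_nneseries => [m _ _|m _].
      by apply: integral_ge0 => x _; rewrite lee_fin.
    rewrite Rintegral_EFin// lee_fin (le_trans (intu m))//.
    by rewrite addn1 expnS natrM invfM mulrA divff// mul1r natrX.
  by have /cvg_lim -> := @cvg_geometric_eseries_half R 2 0; rewrite ?ltry.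
have := integrable_ae measurableT iD; apply: filterS => x /(_ I) Dfin.
have /normed_cvg : cvgn [normed series (fun m => u m.+1 x - u m x)].
  apply: nnseries_is_cvg => //=; under eq_eseriesr do rewrite distrC.
  by move: Dfin; rewrite ge0_fin_numE.
rewrite [X in cvgn X](_ : _ = [sequence u n x - u 0%N x]_n); last exact: telescopeK.
move=> cu; rewrite (_ : u ^~ x = (fun n => u n x - u 0%N x) \+ cst (u 0%N x)).
  by apply: is_cvgD; [exact: cu|exact: is_cvg_cst].
by apply/funext => n /=; rewrite subrK.
Qed.

End bounded_measurable.

(** * Minimisation of the Huber functional over a space of functions *)

Section annihilator.
Context d (T : measurableType d) (R : realType) (P : probability T R).
Context (H : set (T -> R)) (f : T -> R).
Hypothesis Hb : H `<=` @bounded_measurable d T R.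
Hypothesis H0 : H (fun=> 0).
Hypothesis HL : forall a h k, H h -> H k -> H (fun x => a * h x + k x).
Hypothesis bf : bounded_measurable f.

Let J (h : T -> R) := \int[P]_x huber (f x - h x).

Let bH h : H h -> bounded_measurable (fun x => f x - h x).
Proof. by move=> /Hb; exact: bounded_measurableB. Qed.

(** The error [16^-1 * 4 ^- m] is chosen so that the truncated residuals of consecutive terms end up
    within [2 ^- m] in L^1. *)
Let minimizing_sequence : exists h : nat -> T -> R, (forall m, H (h m)) /\
  forall m k, H k -> J (h m) <= J k + 16^-1 * 4 ^- m.
Proof.
have Jinf : has_inf [set J h | h in H].
  split; first by exists (J (fun=> 0)), (fun=> 0).
  by exists 0 => _ [h _ <-]; apply: Rintegral_ge0 => x _; exact: huber_ge0.
have ex m : exists h, H h /\ forall k, H k -> J h <= J k + 16^-1 * 4 ^- m.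
  have /inf_adherent /(_ Jinf)[_ [h Hh <-] Jh] : 0 < 16^-1 * 4 ^- m :> R.
    by rewrite mulr_gt0// invr_gt0// exprn_gt0.
  exists h; split => // k Hk; apply: le_trans (ltW Jh) _; rewrite lerD2r.
  by apply: ge_inf; [exact: Jinf.2|exists k].
have /all_sig[h hP] m := cid (ex m).
by exists h; split => m; [have [] := hP m|move=> k; apply: (hP m).2].
Qed.

(** The midpoint of [h] and [k] is in [H], so its value of [J] is at least those of [h] and [k]
    minus [e]; integrating [huber_midpoint] leaves only [e] for one eighth of the squared L^2
    distance. *)
Let near_minimizers_close h k (e : R) : H h -> H k ->
  (forall g, H g -> J h <= J g + e) -> (forall g, H g -> J k <= J g + e) ->
  \int[P]_x (clamp (f x - h x) - clamp (f x - k x)) ^+ 2 <= 8 * e.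
Proof.
move=> Hh Hk Jh Jk.
have Hm : H (fun x => 2^-1 * h x + (2^-1 * k x + 0)) by do 2! apply: HL => //.
have {}Jh := Jh _ Hm; have {}Jk := Jk _ Hm.
have bhm := bounded_measurable_huber (bH Hm).
have bhh := bounded_measurable_huber (bH Hh).
have bhk := bounded_measurable_huber (bH Hk).
have bc : bounded_measurable
    (fun x => (clamp (f x - h x) - clamp (f x - k x)) ^+ 2).
  apply: bounded_measurableX; apply: bounded_measurableB;
    exact/bounded_measurable_clamp/(bH _).1.
have : \int[P]_x (8 * huber (f x - (2^-1 * h x + (2^-1 * k x + 0))) +
    (clamp (f x - h x) - clamp (f x - k x)) ^+ 2) <=
  \int[P]_x (4 * huber (f x - h x) + 4 * huber (f x - k x)).
  apply: le_Rintegral => //.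
  - by apply: bounded_measurable_integrable => //; apply: bounded_measurableD => //;
      exact: bounded_measurableZ.
  - by apply: bounded_measurable_integrable => //; apply: bounded_measurableD => //;
      exact: bounded_measurableZ.
  - move=> x _; have := huber_midpoint (f x - h x) (f x - k x).
    rewrite (_ : (_ + _) / 2 = f x - (2^-1 * h x + (2^-1 * k x + 0))); first lra.
    by lra.
have bI g : bounded_measurable g -> P.-integrable setT (EFin \o g).
  exact: bounded_measurable_integrable.
rewrite !RintegralD ?RintegralZl//; try by apply: bI => //; exact: bounded_measurableZ.
by move: Jh Jk; rewrite /J; lra.
Qed.

(** The orthogonality of [g] to [H] is the first-order condition for a minimum, [clamp] being the
    derivative of [huber]. No minimiser in [H] is required: only the derivatives along a minimising
    sequence converge. *)
Lemma annihilator_of_residuals : exists (h : nat -> T -> R) (g : T -> R),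
  [/\ forall m, H (h m),
      \forall x \ae P, clamp (f x - h m x) @[m --> \oo] --> g x,
      measurable_fun setT g, forall x, -1 <= g x <= 1
    & forall k, H k -> \int[P]_x (g x * k x) = 0].
Proof.
have [h [Hh Jh]] := minimizing_sequence.
pose c m x := clamp (f x - h m x).
have bc m : bounded_measurable (c m).
  exact/bounded_measurable_clamp/(bH _).1.
have cB x : bounded_fun (c ^~ x : nat -> R^o).
  exists 1; split; first exact: num_real.
  move=> N N1 m _; apply: le_trans (ltW N1).
  by rewrite ler_norml clamp_itv.
have cae : \forall x \ae P, cvgn (c ^~ x).
  apply: cvg_ae_of_summable => // m.
  have Jm1 k : H k -> J (h m.+1) <= J k + 16^-1 * 4 ^- m.
    move=> Hk; apply: le_trans (Jh _ _ Hk) _; rewrite lerD2l ler_pM2l//.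
    by rewrite lef_pV2 ?posrE ?exprn_gt0// ler_weXn2l// ler1n.
  have := near_minimizers_close (Hh m) (Hh m.+1) (Jh m) Jm1.
  rewrite mulrA => cl.
  have bd : bounded_measurable (fun x => c m x - c m.+1 x).
    exact: bounded_measurableB.
  have p0 : 0 < 2 ^+ m :> R by rewrite exprn_gt0.
  (* AM-GM: [2 |t| <= 2 ^ m t ^ 2 + 2 ^ (- m)] *)
  apply: (@le_trans _ _ (\int[P]_x (2 ^+ m / 2 * (c m x - c m.+1 x) ^+ 2 + 2 ^- m / 2))).
    apply: le_Rintegral => //.
    - exact/bounded_measurable_integrable/bounded_measurable_norm.
    - apply: bounded_measurable_integrable => //; apply: bounded_measurableD.
        exact/bounded_measurableZ/bounded_measurableX.
      exact: bounded_measurable_cst.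
    - move=> x _; rewrite -(real_normK (num_real (_ - _))).
      set t := `|_|.
      have : 0 <= (2 ^+ m * t - 1) ^+ 2 / 2 ^+ m / 2.
        by rewrite !divr_ge0 ?sqr_ge0// ltW.
      rewrite (_ : _ / 2 ^+ m / 2 = 2 ^+ m / 2 * t ^+ 2 + 2 ^- m / 2 - t); first lra.
      by field; rewrite gt_eqF.
  rewrite RintegralD//; first last.
  - exact/bounded_measurable_integrable/bounded_measurable_cst.
  - exact/bounded_measurable_integrable/bounded_measurableZ/bounded_measurableX.
  rewrite RintegralZl//; last first.
    exact/bounded_measurable_integrable/bounded_measurableX.
  rewrite Rintegral_cst// (_ : fine (P setT) = 1) ?probability_setT// mulr1.
  have := ler_wpM2l (ltW p0) cl.
  rewrite (_ : (4 : R) ^- m = 2 ^- m * 2 ^- m); last first.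
    by rewrite -invfM -exprMn; congr (_ ^- _); lra.
  have -> : 2 ^+ m * (8 / 16 * (2 ^- m * 2 ^- m)) = 2^-1 * 2 ^- m :> R.
    by field; rewrite gt_eqF.
  have : 0 < 2 ^- m :> R by rewrite invr_gt0.
  by rewrite /c; lra.
(* The upper limit makes [g] measurable and defined everywhere; the outer [clamp] gives the bound at
   every point, including those where [c ^~ x] diverges. *)
pose g x := clamp (limn_sup (c ^~ x : nat -> R^o)).
have cg : \forall x \ae P, c m x @[m --> \oo] --> g x.
  apply: filterS cae => x cx; rewrite /g cvg_limn_supE// clamp_id//.
  by rewrite limr_ge ?limr_le//; apply: nearW => m;
    have /andP[] := clamp_itv (f x - h m x).
have mg : measurable_fun setT g.
  apply/measurable_clamp/measurable_fun_limn_sup => [x _|x _|m]; last exact: (bc m).1.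
  - exact: bounded_fun_has_ubound.
  - exact: bounded_fun_has_lbound.
exists h, g; split=> // [x|k Hk]; first exact: clamp_itv.
have bk := Hb Hk.
have bI u : bounded_measurable u -> P.-integrable setT (EFin \o u).
  exact: bounded_measurable_integrable.
have bg : bounded_measurable g by split=> //; exists 1 => x; rewrite ler_norml clamp_itv.
(* Dominated convergence with majorant [|k|], since the [c m] are bounded by 1. *)
have ckg : \int[P]_x (c m x * k x) @[m --> \oo] --> \int[P]_x (g x * k x).
  have ae_cvg : \forall x \ae P, setT x ->
      (c m x * k x)%:E @[m --> \oo] --> (g x * k x)%:E.
    by apply: filterS cg => x cx _; apply: cvg_EFin;
      [exact: nearW|exact: cvgMr_tmp].
  have ae_le : \forall x \ae P, forall m, setT x ->
      (`|(c m x * k x)%:E| <= (`|k x|)%:E)%E.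
    apply/aeW => x m _; rewrite lee_fin normrM ler_piMl//.
    by rewrite ler_norml clamp_itv.
  have [_ _] := dominated_convergence measurableT
    (fun m => (measurable_EFinP _ _).2 (bounded_measurableM (bc m) bk).1)
    ((measurable_EFinP _ _).2 (bounded_measurableM bg bk).1)
    ae_cvg (bI _ (bounded_measurable_norm bk)) ae_le.
  rewrite Rintegral_EFin//; last exact: bounded_measurableM.
  by move/fine_cvg; exact.
pose K := \int[P]_x k x ^+ 2.
have K0 : 0 <= K by apply: Rintegral_ge0 => x _; exact: sqr_ge0.
(* Compare [J] at [h m] and at [h m - t k], using [huberD_le], and let the minimisation error tend
   to 0. *)
have quad t : 0 <= t * \int[P]_x (g x * k x) + t ^+ 2 / 2 * K.
  have cq : t * \int[P]_x (c m x * k x) + t ^+ 2 / 2 * K + 16^-1 * 4 ^- m @[m --> \oo]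
      --> t * \int[P]_x (g x * k x) + t ^+ 2 / 2 * K + 16^-1 * 0.
    apply: cvgD; last first.
      apply: cvgMl_tmp; rewrite (_ : (fun m => 4 ^- m) = (fun m => 4^-1 ^+ m : R)).
        by apply: cvg_expr; rewrite gtr0_norm ?invr_gt0// invf_lt1// ltr1n.
      by apply/funext => m; rewrite exprVn.
    by apply: cvgD; [exact: cvgMl_tmp|exact: cvg_cst].
  rewrite mulr0 addr0 in cq.
  rewrite -(cvg_lim _ cq)//; apply: limr_ge; first by apply/cvg_ex; eexists; exact: cq.
  apply: nearW => m.
  have Ht : H (fun x => - t * k x + h m x) by exact: HL.
  have := Jh m _ Ht.
  have : J (fun x => - t * k x + h m x) <=
      \int[P]_x (huber (f x - h m x) + (t * (c m x * k x) + t ^+ 2 / 2 * k x ^+ 2)).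
    apply: le_Rintegral => //.
    - exact/bI/bounded_measurable_huber/bH.
    - apply: bI; apply: bounded_measurableD; first exact/bounded_measurable_huber/bH.
      apply: bounded_measurableD; apply: bounded_measurableZ.
        exact: bounded_measurableM.
      exact: bounded_measurableX.
    - move=> x _; have := huberD_le (f x - h m x) (t * k x).
      by rewrite /c (_ : _ + t * k x = f x - (- t * k x + h m x)); lra.
  have bck : bounded_measurable (fun x => c m x * k x) by exact: bounded_measurableM.
  have bkk : bounded_measurable (fun x => k x ^+ 2) by exact: bounded_measurableX.
  rewrite (@RintegralD _ _ _ _ _ (fun x => huber _))//; first last.
  - by apply/bI/bounded_measurableD; exact: bounded_measurableZ.
  - exact/bI/bounded_measurable_huber/bH.
  rewrite (@RintegralD _ _ _ _ _ (fun x => t * _)) ?RintegralZl//; try exact: bI.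
  - by rewrite /J /K; lra.
  - exact/bI/bounded_measurableZ.
  - exact/bI/bounded_measurableZ.
set a := \int[P]_x (g x * k x) in quad *.
(* The quadratic has its minimum at [- a / K]; [K + 1] avoids a division by 0 and still gives a
   negative value unless [a] is 0. *)
have := quad (- a / (K + 1)).
have K1 : 0 < (K + 1) ^+ 2 by rewrite exprn_gt0// ltr_wpDl.
rewrite (_ : _ + _ = (- a ^+ 2 * (1 + K / 2)) / (K + 1) ^+ 2); last first.
  by field; rewrite gt_eqF// ltr_wpDl.
rewrite pmulr_lge0 ?invr_gt0// mulNr oppr_ge0 => a0.
apply/eqP; rewrite -sqrf_eq0 eq_le sqr_ge0 andbT.
by move: a0; rewrite pmulr_lle0//; lra.
Qed.
End annihilator.

(** * Densities and extremality *)

Lemma probability_of_density d (T : measurableType d) (R : realType)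
    (P : probability T R) (w : T -> R) :
  bounded_measurable w -> (forall x, 0 <= w x) -> \int[P]_x w x = 1 ->
  exists Q : probability T R, forall A : set T, measurable A ->
    Q A = (\int[P]_(x in A) w x)%:E.
Proof.
move=> bw w0 w1.
pose m (A : set T) : \bar R := (\int[P]_(x in A) (w x)%:E)%E.
have m0 : m set0 = 0%E by rewrite /m integral_set0.
have mge0 A : (0 <= m A)%E by apply: integral_ge0 => x _; rewrite lee_fin.
have msigma : semi_sigma_additive m.
  apply: semi_sigma_additive_nng_induced => [|x]; last by rewrite lee_fin.
  exact/measurable_EFinP/bw.1.
have mT : m setT = 1%E by rewrite /m Rintegral_EFin// w1.
pose M : {measure set T -> \bar R} :=
  HB.pack m (isMeasure.Build _ _ _ m m0 mge0 msigma).
pose Q : probability T R :=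
  HB.pack (Measure.sort M) (@Measure_isProbability.Build _ _ _ (Measure.sort M) mT).
by exists Q => A mA; exact: Rintegral_EFin.
Qed.

Lemma ae_eq0_of_Rintegral d (T : measurableType d) (R : realType)
    (P : probability T R) (g : T -> R) : bounded_measurable g ->
  (forall A, measurable A -> \int[P]_(x in A) g x = 0) ->
  \forall x \ae P, g x = 0.
Proof.
move=> bg g0.
have := @integral_ae_eq _ _ _ P setT measurableT (cst 0%E) (EFin \o g)
  (bounded_measurable_integrable P measurableT bg) (measurable_cst _).
move=> /(_ _)/wrap[E _ mE|].
  by rewrite integral0 Rintegral_EFin// g0.
by apply: filterS => x /(_ I)[].
Qed.

(** The measures with densities [1 + g] and [1 - g] have the marginals of [mu], and [mu] is their
    midpoint. Extremality identifies them with [mu], so [g] has integral 0 over every measurable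
    set. *)
Lemma simplicial_annihilator (R : realType) (n : nat)
    (X : 'I_n -> ptopologicalType) (mu : probability (product_borel X) R)
    (g : product_borel X -> R) :
  simplicial mu -> measurable_fun setT g -> (forall x, -1 <= g x <= 1) ->
  \int[mu]_x g x = 0 ->
  (forall i (A : set (borel (X i))), measurable A ->
    \int[mu]_(x in @factor_proj n X i @^-1` A) g x = 0) ->
  \forall x \ae mu, g x = 0.
Proof.
move=> [_ ext] mg g1 gT gA.
have bg : bounded_measurable g.
  by split=> //; exists 1 => x; rewrite ler_norml g1.
(* The condition [e ^+ 2 = 1] treats the signs 1 and -1 together. *)
have Q_of (e : R) : e ^+ 2 = 1 -> exists Q : probability (product_borel X) R,
    [set l | same_marginals l mu] Q /\
    forall A, measurable A -> Q A = (mu A + (e * \int[mu]_(x in A) g x)%:E)%E.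
  move=> e1.
  have bw : bounded_measurable (fun x => 1 + e * g x).
    apply: bounded_measurableD; first exact: bounded_measurable_cst.
    exact: bounded_measurableZ.
  have wE (A : set (product_borel X)) : measurable A ->
      (\int[mu]_(x in A) (1 + e * g x))%:E = (mu A + (e * \int[mu]_(x in A) g x)%:E)%E.
    move=> mA; rewrite RintegralD// ?RintegralZl// ?Rintegral_cst//.
    - rewrite mul1r EFinD fineK// fin_num_measure//.
    - exact: bounded_measurable_integrable.
    - exact/bounded_measurable_integrable/bounded_measurable_cst.
    - exact/bounded_measurable_integrable/bounded_measurableZ.
  have [||Q QE] := @probability_of_density _ _ _ mu (fun x => 1 + e * g x) bw.
  - move=> x; have /andP[? ?] := g1 x.
    by move/eqP : e1; rewrite sqrf_eq1 => /orP[] /eqP ->; lra.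
  - by apply: EFin_inj; rewrite wE// gT mulr0 probability_setT adde0.
  - exists Q; split => [i A mA|A mA]; last by rewrite QE// wE.
    have mpA : measurable (@factor_proj n X i @^-1` A).
      by rewrite -[X in measurable X]setTI; exact: measurable_factor_proj.
    by rewrite /marginal /pushforward QE// wE// gA// mulr0 adde0.
have [Q1 [mQ1 Q1E]] := Q_of 1 (expr1n _ _).
have [Q2 [mQ2 Q2E]] := Q_of (-1) (etrans (sqrrN 1) (expr1n _ _)).
apply: ae_eq0_of_Rintegral => // A mA.
have half : 0 < (2^-1 : R) < 1 by lra.
have [|+ _] := ext Q1 Q2 2^-1 mQ1 mQ2 half _ A mA.
  move=> B mB; rewrite Q1E// Q2E// -(fineK (fin_num_measure mu B mB)).
  by rewrite -!EFinD; congr EFin; lra.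
rewrite Q1E// -(fineK (fin_num_measure mu A mA)) -EFinD => -[]; lra.
Qed.

(** * Countable separation of points in a Polish space *)

(** The sets are the balls with centre in a countable dense set and radius [k.+1%:R^-1]. *)
Lemma separating_opens (R : realType) (T : ptopologicalType) : polish R T ->
  exists U : nat * nat -> set T, (forall k, open (U k)) /\
    forall x y, x <> y -> exists k, U k x /\ ~ U k y.
Proof.
move=> [[D /countable_injP[j jinj] Dd] [M [f [g [fK gK cf cg _]]]]].
(* [q] enumerates [D] by inverting [j]; indices outside the image of [j] get the default [point],
   which is harmless. *)
pose q k := xget point [set z | D z /\ j z = k].
have qE z : D z -> q (j z) = z.
  move=> Dz; have [Dq jq] : [set t | D t /\ j t = j z] (q (j z)).
    by apply: xgetPex; exists z.
  by apply: jinj; rewrite ?inE.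
pose B (k : nat * nat) := ball (f (q k.1)) (k.2.+1%:R^-1 : R).
have ob (c : M) (r : R) : open (f @^-1` ball c r).
  apply: open_comp => [z _|]; first exact: cf.
  rewrite openE => z; rewrite ballEmdist/= => zr.
  rewrite /interior -filter_from_ballE/=.
  exists (r - mdist c z); first by rewrite /= subr_gt0.
  move=> w; rewrite !ballEmdist/= => zw.
  by apply: le_lt_trans (metric_triangle _ z _) _; rewrite -ltrBrDl.
exists (fun k => f @^-1` B k); split => [k|x y xy]; first exact: ob.
have d0 : 0 < mdist (f x) (f y).
  by rewrite mdist_gt0; apply/eqP => /(congr1 g); rewrite !fK.
(* With a radius below half the distance, no ball contains the images of both [x] and [y]. *)
have [k kd] : exists k, k.+1%:R^-1 < mdist (f x) (f y) / 2 :> R.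
  exists (Num.truncn (mdist (f x) (f y) / 2)^-1).
  rewrite invf_plt ?posrE ?divr_gt0//; exact: truncnS_gt.
have [z [xz Dz]] : (f @^-1` ball (f x) (k.+1%:R^-1 : R)) `&` D !=set0.
  by apply: Dd => //; exists x; apply: ballxx; rewrite invr_gt0.
move: xz; rewrite /= ballEmdist/= => xz.
exists (j z, k); rewrite /B/= qE// !ballEmdist/=; split; first by rewrite metric_sym.
move=> zy; have := metric_triangle (f x) (f z) (f y).
by move: kd xz zy; set r := _^-1; lra.
Qed.

(** * Goodness from separation by limits of sums *)

(** Each point of [S] is viewed as the functional [e x] on families [u]; separation makes these
    functionals independent, so a linear form [L] can take any prescribed real values on them.
    Complex values are treated by real and imaginary parts. *)
Lemma good_of_separation (R : realType) (n : nat)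
    (X : 'I_n -> ptopologicalType) (S : set (prod_topology X)) :
  (forall (x : prod_topology X) (s : seq (prod_topology X)),
    S x -> (forall y, y \in s -> S y) -> x \notin s ->
    exists v : nat -> forall i, X i -> R,
      \sum_(i < n) v m i (x i) @[m --> \oo] --> (1 : R) /\
      forall y, y \in s -> \sum_(i < n) v m i (y i) @[m --> \oo] --> (0 : R)) ->
  good R S.
Proof.
move=> sep.
pose e (x : set_type S) (u : forall i, X i -> R) : R^o :=
  \sum_(i < n) u i (val x i).
have real_good (f : set_type S -> R) : exists u : forall i, X i -> R,
    forall x, f x = \sum_(i < n) u i (val x i).
  have [x s xs|L Le] := @interpolation_of_separation R (set_type S) _ e _ f.
    have Ss y : y \in map val s -> S y by move=> /mapP[z _ ->]; exact: set_valP.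
    have xs' : val x \notin map val s.
      by apply/mapP => -[z zs /val_inj xz]; rewrite xz zs in xs.
    have [v [v1 v0]] := sep _ _ (set_valP x) Ss xs'.
    by exists v; split => // y ys; apply: v0; rewrite map_f.
  (* [e x] is the sum over [i] of the evaluations of [u] at the points [x i]. *)
  exists (fun i t => L (fun u => u i t)) => x.
  rewrite -Le -linear_sum; congr (L _); apply/funext => u.
  by rewrite fct_sumE.
move=> f.
have [u uE] := real_good (fun x => complex.Re (f x)).
have [w wE] := real_good (fun x => complex.Im (f x)).
exists (fun i t => Complex (u i t) (w i t)) => x.
apply/eqP; rewrite eq_complex !raddf_sum/=; apply/andP; split; apply/eqP.
- exact: uE.
- exact: wE.
Qed.

(** * Approximation by sums under a simplicial measure *)

Lemma simplicial_approximation (R : realType) (n : nat) (hn : (1 <= n)%N)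
    (X : 'I_n -> ptopologicalType) (mu : probability (product_borel X) R)
    (f : product_borel X -> R) : simplicial mu -> bounded_measurable f ->
  exists v : nat -> forall i, X i -> R,
    \forall x \ae mu, \sum_(i < n) v m i (factor_proj i x) @[m --> \oo] --> f x.
Proof.
move=> smu bf.
pose H := [set h : product_borel X -> R | bounded_measurable h /\
  exists u : forall i, X i -> R, forall x, h x = \sum_(i < n) u i (factor_proj i x)].
have [| | | |h [g [Hh hg mg g1 gH]]] := @annihilator_of_residuals _ _ _ mu H f.
- by move=> h [].
- split; first exact: bounded_measurable_cst.
  by exists (fun i t => 0) => x; rewrite big1.
- move=> a h k [bh [u uE]] [bk [v vE]]; split.
    by apply: bounded_measurableD => //; exact: bounded_measurableZ.
  exists (fun i t => a * u i t + v i t) => x.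
  by rewrite uE vE mulr_sumr -big_split.
- exact: bf.
have gA i (A : set (borel (X i))) : measurable A ->
    \int[mu]_(x in @factor_proj n X i @^-1` A) g x = 0.
  move=> mA.
  have mpA : measurable (@factor_proj n X i @^-1` A).
    by rewrite -[X in measurable X]setTI; exact: measurable_factor_proj.
  rewrite Rintegral_mkcond patch_indic; apply: (gH (\1_(@factor_proj n X i @^-1` A))).
  split; first exact: bounded_measurable_indic.
  (* The family with the indicator of [A] at index [i] and 0 elsewhere shows that the indicator of
     the cylinder over [A] is in [H]. *)
  exists (dfwith (fun k (_ : X k) => 0) i (\1_A : X i -> R)) => x.
  rewrite (bigD1 i)//= dfwithin big1 ?addr0 => [|k ki].
    by rewrite !indicE; congr (_%:R); congr nat_of_bool; rewrite !in_setE.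
  by rewrite dfwithout// eq_sym.
(* The whole space is the cylinder over [setT] at index 0, available because [n] is positive. *)
have gT : \int[mu]_x g x = 0 by rewrite -(gA (Ordinal hn) setT measurableT).
have := simplicial_annihilator smu mg g1 gT gA.
have /all_sig[v vE] m := cid (Hh m).2.
move=> g0; exists v; near=> x.
have gx : g x = 0 by near: x.
have : clamp (f x - h m x) @[m --> \oo] --> g x by near: x.
rewrite gx => /cvg_clamp0 fh.
have -> : (fun m => \sum_(i < n) v m i (factor_proj i x)) =
    (fun m => f x - (f x - h m x)).
  by apply/funext => m; rewrite vE opprB addrC subrK.
rewrite -[X in _ --> X]subr0; apply: cvgB => //; exact: cvg_cst.
Unshelve. all: by end_near. Qed.

(** * Construction of the good support *)

Theorem theorem5p1 (R : realType) (n : nat) (hn : (1 <= n)%N)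
    (X : 'I_n -> ptopologicalType) (hX : forall i : 'I_n, polish R (X i))
    (mu : probability (product_borel X) R) (hmu : simplicial mu) :
  exists S : set (product_borel X),
    [/\ measurable S, mu S = 1%E & good R S].
Proof.
have /all_sig[U UP] i := cid (separating_opens (hX i)).
pose B (s : seq ('I_n * (nat * nat))) : set (product_borel X) :=
  \big[setI/setT]_(p <- s) (@factor_proj n X p.1 @^-1` U p.1 p.2).
have BP s x : B s x <-> forall p, p \in s -> U p.1 p.2 (x p.1).
  rewrite /B; elim: s => [|p s IH]; first by rewrite big_nil; split.
  rewrite big_cons; split=> [[xp /IH xs] q|xs].
    by rewrite in_cons => /orP[/eqP ->//|/xs].
  split; first by apply: xs; rewrite mem_head.
  by apply/IH => q qs; apply: xs; rewrite in_cons qs orbT.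
have mB s : measurable (B s).
  apply: bigsetI_measurable => p _; rewrite -[X in measurable X]setTI.
  apply: measurable_factor_proj => //; apply: sub_sigma_algebra.
  exact: (UP p.1).1.
have /all_sig[v vP] s :=
  cid (simplicial_approximation hn hmu (@bounded_measurable_indic _ _ R _ (mB s))).
(* Finite sequences are enumerated by integers so that one null set [N] serves for all the sets
   [B s]; integers that code no sequence yield [[::]]. *)
pose dec k : seq ('I_n * (nat * nat)) := odflt [::] (unpickle k).
have [N [mN N0 vN]] : \forall x \ae mu, forall k,
    \sum_(i < n) v (dec k) m i (factor_proj i x) @[m --> \oo] -->
      (\1_(B (dec k)) x : R).
  by apply: ae_foralln => k; exact: vP.
have vB x s : (~` N) x ->
    \sum_(i < n) v s m i (factor_proj i x) @[m --> \oo] --> (\1_(B s) x : R).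
  move=> Nx; have /contrapT/(_ (pickle s)) := contra_not (vN x) Nx.
  by rewrite /dec pickleK.
exists (~` N); split; first exact: measurableC.
  by rewrite probability_setC// N0 sube0.
apply: good_of_separation => x s Nx Ns xs.
(* For each [y] in [s], a coordinate where [x] and [y] differ contributes one open set containing
   [x i] but not [y i]; [B r] is the intersection of the corresponding cylinders. *)
have [r [xr yr]] : exists r, B r x /\ forall y, y \in s -> ~ B r y.
  elim: s xs {Ns} => [|y s IH]; first by exists [::]; split => //; apply/BP.
  rewrite in_cons negb_or => /andP[xy /IH[r [/BP xr yr]]].
  have [i xyi] : exists i, x i <> y i.
    apply: contrapT => /forallNP xyE; move/eqP : xy; apply.
    by apply: functional_extensionality_dep => i; apply: contrapT; exact: xyE.
  have [k [xk yk]] := (UP i).2 _ _ xyi.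
  exists ((i, k) :: r); split.
    by apply/BP => p; rewrite in_cons => /orP[/eqP ->//|/xr].
  move=> z; rewrite in_cons => /orP[/eqP ->|zs] /BP zr.
    by apply: yk; apply: (zr (i, k)); rewrite mem_head.
  by apply: (yr z zs); apply/BP => p pr; apply: zr; rewrite in_cons pr orbT.
exists (v r); split => [|y ys].
  by have := vB x r Nx; rewrite indicE mem_set.
by have := vB y r (Ns y ys); rewrite indicE memNset//; exact: yr.
Qed.
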